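(* Let $(V,\omega)$ be a real $2n$-dimensional symplectic vector space and let $D$ and $\widetilde D$ be $n$-dimensional subspaces of $V$. Then $$\mathrm{E}_{\widetilde D}=\mathrm{E}_D\iff \widetilde D=D\ \text{ or }\ \widetilde D=D^\perp .$$
   Context: $\mathcal{L}(V)$ is the set of Lagrangian planes of $(V,\omega)$ ($n$-dimensional subspaces on which $\omega$ vanishes). For an $n$-dimensional subspace $D\subset V$, $\mathrm{E}_D=\{L\in\mathcal{L}(V)\mid L\cap D\neq0\}$, and $D^\perp$ denotes the orthogonal complement of $D$ with respect to $\omega$. *)

(* Defs.v *)
From mathcomp Require Import all_boot all_algebra.
From mathcomp Require Import classical_sets reals.

Set Implicit Arguments.
Unset Strict Implicit.
Unset Printing Implicit Defensive.

Import GRing.Theory.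

Local Open Scope ring_scope.
Local Open Scope classical_set_scope.

(* The half-dimension n is an explicit parameter: these are the usual notions
   when omega is symplectic and \dim {:V} = 2 * n. *)
Definition lagrangian_planes (R : realType) (V : vectType R)
    (omega : {skew_symmetric V}) (n : nat) : set {vspace V} :=
  [set L | \dim L = n /\ {in L &, forall u v, omega u v = 0}].

Definition E_set (R : realType) (V : vectType R)
    (omega : {skew_symmetric V}) (n : nat) (D : {vspace V}) : set {vspace V} :=
  [set L | lagrangian_planes omega n L /\ (L :&: D)%VS <> 0%VS].

(* Main.v *)
Require Import Defs.
From mathcomp Require Import all_boot all_algebra.
From mathcomp Require Import classical_sets reals.
From mathcomp Require Import zify.

(** For a Lagrangian plane [L] the inclusion of [L + D^_|_] in [(L :&: D)^_|_]
    and a dimension count give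
    [\dim (L :&: D) <= \dim (L :&: D^_|_)], and exchanging [D] and [D^_|_]
    gives equality: [L] meets [D] exactly when it meets [D^_|_]
    ([dim_lagrangian_cap_orthov]).

    Conversely, suppose that [D'] is neither [D] nor [D^_|_].  Since all three
    have the same dimension, [D'] is contained in neither of the two others,
    and, a vector space not being the union of two proper subspaces, some [v]
    in [D'] avoids both [D] and [D^_|_].  The line through [v] extends to a
    Lagrangian plane transverse to [D] ([extend_lagrangian_transverse]); this
    plane meets [D'], because it contains [v], but does not meet [D], so that
    [D] and [D'] have different sets of incident Lagrangian planes.

    The extension is built one vector at a time.  The invariant is that the
    isotropic subspace [I] under construction meets neither [D] nor [D^_|_].
    Keeping track of [D^_|_] as well is what makes the induction work: it
    guarantees that [I^_|_] is not swallowed by [I + D], and symmetrically, so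
    that a suitable next vector exists as long as [\dim I < n]. *)

Set Implicit Arguments.
Unset Strict Implicit.
Unset Printing Implicit Defensive.

Import GRing.Theory.

Local Open Scope ring_scope.

(** * Subspaces and unions *)

Lemma avoid_two_subspaces (F : fieldType) (V : vectType F)
    (U A B : {vspace V}) :
    ~~ (U <= A)%VS -> ~~ (U <= B)%VS ->
  exists2 v, v \in U & (v \notin A) && (v \notin B).
Proof.
move=> /subvPn[a aU aA] /subvPn[b bU bB].
have [aB|aB] := boolP (a \in B); last by exists a; rewrite ?aA.
have [bA|bA] := boolP (b \in A); last by exists b; rewrite ?bA.
exists (a + b); first exact: memvD.
by rewrite rpredDr // rpredDl // aA.
Qed.

Lemma cap_add_line_eq0 (F : fieldType) (V : vectType F) (I D : {vspace V}) v :
  (I :&: D = 0)%VS -> v \notin (I + D)%VS -> ((I + <[v]>) :&: D = 0)%VS.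
Proof.
move=> ID0 vID; apply/eqP; rewrite -subv0; apply/subvP => x.
rewrite memv_cap => /andP[/memv_addP[i iI [_ /vlineP[a ->] ->]]].
have [->|a0 iavD] := eqVneq a 0.
  by rewrite scale0r addr0 => iD; rewrite -ID0 memv_cap iI.
case/negP: vID; rewrite -[v](scalerK a0) memvZ // -(addKr i (a *: v)).
by rewrite memv_add // memvN.
Qed.

Lemma line_cap_eq0 (F : fieldType) (V : vectType F) (W : {vspace V}) v :
  v \notin W -> (<[v]> :&: W = 0)%VS.
Proof.
by move=> vW; rewrite -(add0v <[v]>%VS) cap_add_line_eq0 ?cap0v ?add0v.
Qed.

(** * Dimension of the orthogonal complement *)

Section Orthogonal.
Variables (F : fieldType) (eps : bool) (theta : {rmorphism F -> F}).
Variables (V : vectType F) (form : {hermitian V for eps & theta}).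
Implicit Types (U W : {vspace V}).

Lemma orthovS U W : (U <= W)%VS -> (orthov form W <= orthov form U)%VS.
Proof.
move=> /subvP UW; apply/subvP => x /mem_orthovP xW.
by apply/mem_orthovP => v /UW; apply: xW.
Qed.

Lemma orthov_add U W :
  orthov form (U + W) = (orthov form U :&: orthov form W)%VS.
Proof.
apply: subv_anti; apply/andP; split.
  by rewrite subv_cap !orthovS ?addvSl ?addvSr.
by rewrite orthovD capvSl capvSr.
Qed.

(** Each vector of a basis of [U] imposes one linear condition. *)
Lemma dim_orthov_geq U : (\dim {:V} <= \dim (orthov form U) + \dim U)%N.
Proof.
suff spanX (X : seq V) : (\dim {:V} <= \dim (orthov form <<X>>) + size X)%N.
  by have := spanX (vbasis U); rewrite (span_basis (vbasisP U)) size_tuple.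
elim: X => [|x X IHX]; first by rewrite span_nil orthov0 addn0.
rewrite span_cons orthov_add capvC /=.
have := leq_dim_orthov1 form x (orthov form <<X>>).
by rewrite -(leq_add2r (size X).+1); apply: leq_trans; rewrite addnS -addSn
  (leq_trans IHX) // leq_add2r leqSpred.
Qed.

Hypothesis form_nondeg : nondegenerate form.

(** The bound [dim_orthov_geq] for [U] and for a complement [W] of [U] adds up
    to the dimension of the whole space, and [U^_|_] and [W^_|_] are
    independent because a common vector lies in the radical: no slack is left
    in either bound. *)
Lemma dim_orthov U : (\dim (orthov form U) + \dim U = \dim {:V})%N.
Proof.
apply/eqP; rewrite eqn_leq dim_orthov_geq andbT.
have UW0 : (orthov form U :&: orthov form U^C = 0)%VS.
  by rewrite -orthov_add addv_complf; apply/eqP.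
have dimUW := dimvS (subvf (orthov form U + orthov form U^C)).
rewrite dimv_disjoint_sum // in dimUW.
have dimW := dim_orthov_geq U^C.
rewrite dimv_compl in dimW.
have := dimvS (subvf U); lia.
Qed.

Lemma orthovK U : orthov form (orthov form U) = U.
Proof.
apply/esym/eqP; rewrite eqEdim orthov_sym subvv /=.
by rewrite -(leq_add2r (\dim (orthov form U))) dim_orthov addnC dim_orthov.
Qed.

End Orthogonal.

(** * Extending isotropic subspaces *)

(** The last clause of [is_psymplectic] covers characteristic 2, where skew
    symmetry says nothing about the diagonal. *)
Lemma psymplectic_alternating (F : fieldType) (V : vectType F)
    (omega : {skew_symmetric V}) (v : V) :
  is_psymplectic omega -> omega v v = 0.
Proof.
case=> _ _ char2; have [/char2->//|] := boolP (2 \in [pchar F]).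
rewrite inE /= => two_neq0; apply/eqP.
have /eqP : omega v v = - omega v v by rewrite {1}hermC /= expr1 mulN1r.
by rewrite -addr_eq0 -mulr2n -mulr_natr mulf_eq0 (negPf two_neq0) orbF.
Qed.

Section Lagrangian.
Variables (F : fieldType) (V : vectType F) (omega : {skew_symmetric V}).
Hypothesis omega_sympl : is_psymplectic omega.
Implicit Types (D I L : {vspace V}) (v : V).

Let omega_nondeg : nondegenerate omega. Proof. by case: omega_sympl. Qed.

Lemma line_isotropic v : (<[v]> <= orthov omega <[v]>)%VS.
Proof. by rewrite orthov11 psymplectic_alternating. Qed.

Lemma add_line_isotropic I v :
    (I <= orthov omega I)%VS -> v \in orthov omega I ->
  (I + <[v]> <= orthov omega (I + <[v]>))%VS.
Proof.
move=> isoI vI; rewrite orthoDv !orthovD isoI line_isotropic andbT /=.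
by rewrite (orthov_sym _ I) -memvE vI.
Qed.

(** If [I^_|_] were contained in [I + D], then [(I + D)^_|_] would be contained
    in [I :&: D^_|_], hence be zero, although [I + D] is not the whole space. *)
Lemma orthov_not_sub_add I D :
    (\dim I + \dim D < \dim {:V})%N -> (I :&: orthov omega D = 0)%VS ->
  ~~ (orthov omega I <= I + D)%VS.
Proof.
move=> dimID ID0; apply/negP => /(orthovS omega); rewrite orthovK // => sub_I.
have /eqP : (orthov omega (I + D) == 0)%VS.
  by rewrite -subv0 -ID0 subv_cap sub_I orthovS ?addvSr.
have := dim_orthov omega_nondeg (I + D).
by move=> + ort0; rewrite ort0 dimv0; have := dimv_sum_cap I D; lia.
Qed.

Variable n : nat.
Hypothesis dimV : \dim {:V} = (2 * n)%N.

Lemma dim_orthov_half D : \dim D = n -> \dim (orthov omega D) = n.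
Proof. by have := dim_orthov omega_nondeg D; lia. Qed.

Lemma extend_lagrangian_transverse D I :
    \dim D = n -> (\dim I <= n)%N -> (I <= orthov omega I)%VS ->
    (I :&: D = 0)%VS -> (I :&: orthov omega D = 0)%VS ->
  exists L, [/\ (I <= L)%VS, \dim L = n, (L <= orthov omega L)%VS
              & (L :&: D = 0)%VS].
Proof.
move=> dimD; have [k] := ubnP (n - \dim I)%N.
elim: k I => // k IHk I ltk leIn isoI ID0 IDo0.
have [dimI|ltIn] := leqP n (\dim I).
  by exists I; split=> //; apply/eqP; rewrite eqn_leq leIn.
have dimDo := dim_orthov_half dimD.
have [||v vI /andP[vD vDo]] :=
    @avoid_two_subspaces _ _ (orthov omega I) (I + D) (I + orthov omega D).
- by apply: orthov_not_sub_add; rewrite // dimD dimV; lia.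
- by apply: orthov_not_sub_add; rewrite ?orthovK // dimDo dimV; lia.
have dimIv : \dim (I + <[v]>) = (\dim I).+1.
  have v0 : v != 0 by apply: contraNneq vD => ->; rewrite mem0v.
  rewrite dimv_disjoint_sum ?dim_vline ?v0 ?addn1 // capvC line_cap_eq0 //.
  by apply: contra vD; apply/subvP/addvSl.
have [|||||L [IvL dimL isoL LD0]] := IHk (I + <[v]>)%VS.
- by rewrite dimIv; lia.
- by rewrite dimIv.
- exact: add_line_isotropic.
- exact: cap_add_line_eq0.
- exact: cap_add_line_eq0.
by exists L; split=> //; apply: subv_trans IvL; apply: addvSl.
Qed.

(** Since [L] is its own orthogonal, [L + D^_|_] is orthogonal to [L :&: D]. *)
Lemma dim_lagrangian_cap_leq D L :
    \dim D = n -> \dim L = n -> (L <= orthov omega L)%VS ->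
  (\dim (L :&: D) <= \dim (L :&: orthov omega D))%N.
Proof.
move=> dimD dimL isoL.
have dimDo := dim_orthov_half dimD.
have : (L + orthov omega D <= orthov omega (L :&: D))%VS.
  by rewrite subv_add (subv_trans isoL) !orthovS ?capvSl ?capvSr.
move/dimvS; have := dim_orthov omega_nondeg (L :&: D).
by have := dimv_sum_cap L (orthov omega D); lia.
Qed.

Lemma dim_lagrangian_cap_orthov D L :
    \dim D = n -> \dim L = n -> (L <= orthov omega L)%VS ->
  \dim (L :&: orthov omega D) = \dim (L :&: D).
Proof.
move=> dimD dimL isoL.
apply/eqP; rewrite eqn_leq dim_lagrangian_cap_leq // andbT.
have := dim_lagrangian_cap_leq (dim_orthov_half dimD) dimL isoL.
by rewrite orthovK.
Qed.

(** A line in [D'] but in neither [D] nor [D^_|_] is the first step of a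
    Lagrangian plane transverse to [D]. *)
Lemma lagrangian_separates D D' :
    \dim D = n -> ~~ (D' <= D)%VS -> ~~ (D' <= orthov omega D)%VS ->
  exists L, [/\ \dim L = n, (L <= orthov omega L)%VS,
                (L :&: D = 0)%VS & (L :&: D' != 0)%VS].
Proof.
move=> dimD D'D D'Do.
have [v vD' /andP[vD vDo]] := avoid_two_subspaces D'D D'Do.
have v0 : v != 0 by apply: contraNneq vD => ->; rewrite mem0v.
have n_gt0 : (0 < n)%N.
  have := dimvS (subvf <[v]>%VS); rewrite dim_vline v0 dimV; lia.
have [|||||L [vL dimL isoL LD0]] := @extend_lagrangian_transverse D <[v]>.
- by [].
- by rewrite dim_vline v0.
- exact: line_isotropic.
- exact: line_cap_eq0.
- exact: line_cap_eq0.
exists L; split=> //; apply: contraNneq v0 => LD'0.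
by rewrite -memv0 -LD'0 memv_cap vD' andbT memvE.
Qed.

End Lagrangian.

(** * Incidence with Lagrangian planes *)

Lemma mem_E_set (R : realType) (n : nat) (V : vectType R)
    (omega : {skew_symmetric V}) (D L : {vspace V}) :
  E_set omega n D L <->
  [/\ \dim L = n, (L <= orthov omega L)%VS & (L :&: D != 0)%VS].
Proof.
split=> [[[dimL isoL] /eqP LD]|[dimL isoL /eqP LD]].
  by split=> //; apply/orthovP.
by split=> //; split=> //; apply/orthovP.
Qed.

Theorem theorem3p19 (R : realType) (n : nat) (V : vectType R)
    (omega : {skew_symmetric V}) (D D' : {vspace V})
    (hV : \dim {:V} = (2 * n)%N) (homega : is_psymplectic omega)
    (hD : \dim D = n) (hD' : \dim D' = n) :
  E_set omega n D' = E_set omega n D <-> D' = D \/ D' = orthov omega D.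
Proof.
split=> [eqE|[->//|->]]; last first.
  apply/seteqP; split=> L /mem_E_set[dimL isoL LD]; apply/mem_E_set; split=> //;
    move: LD; rewrite -!dimv_eq0;
    by rewrite (dim_lagrangian_cap_orthov homega hV).
have [D'D|D'D] := boolP (D' <= D)%VS.
  by left; apply/eqP; rewrite eqEdim D'D hD hD' leqnn.
have [D'Do|D'Do] := boolP (D' <= orthov omega D)%VS.
  right; apply/eqP; rewrite eqEdim D'Do.
  by rewrite (dim_orthov_half homega hV hD) hD' leqnn.
have [L [dimL isoL LD0 LD']] := lagrangian_separates homega hV hD D'D D'Do.
have : E_set omega n D' L by apply/mem_E_set.
by rewrite eqE => /mem_E_set[_ _]; rewrite LD0 eqxx.
Qed.
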